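(* Let $a\ge 3$ be an odd integer. If $t$ is an essential turning point of $f_a$, then $t$ is an even number; moreover $f_a\in\mathcal C_3$.
   Context: $\mathbb N=\{1,2,3,\dots\}$. For $a\in\mathbb N$, the function $f_a:\mathbb N\to\mathbb N$ is defined recursively by $f_a(1)=1$, $f_a(2)=a$, and, for each $n\ge 3$, $f_a(n)$ is the smallest positive integer that is not in $\{f_a(1),\dots,f_a(n-1)\}$ and is coprime with $f_a(n-1)$. A turning point of $f=f_a$ is a natural number $t$ such that either (i) $t>3$ and $f(t)-f(t-1)>1$, or (ii) $t=3$ and $f(3)\neq\min(\mathbb N\setminus\{1,a\})$. An essential turning point (ETP) of $f$ is a turning point $t$ such that, in addition: (i) $t>a$ and $f(t)\ne t$; (ii) $f(t-1)=t-2$; (iii) $\{1,2,\dots,t-1\}=\{f(1),f(2),\dots,f(t-1)\}$. $\mathcal C_3$ is the set of all functions $f_b$ that are eventually identical to $f_3$, i.e. such that there exists $m$ with $f_b(n)=f_3(n)$ for all $n>m$. *)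

(* Defs.v *)
From mathcomp Require Import all_boot.

Set Implicit Arguments.
Unset Strict Implicit.
Unset Printing Implicit Defensive.

(* The set {1, 2, 3, ...} is modelled by the positive elements of nat. *)

Definition fresh (s : seq nat) : pred nat :=
  [pred k | [&& 0 < k, k \notin s & coprime k (head 0 s)]].

Lemma ex_fresh (s : seq nat) : 0 < head 0 s -> exists k, fresh s k.
Proof.
move=> s_gt0; exists (sumn s * head 0 s).+1; rewrite /fresh /=.
apply/andP; split; last first.
  by have := coprimeSn (sumn s * head 0 s); rewrite coprimeMr => /andP[].
apply/negP => ks; suff: (sumn s * head 0 s).+1 <= sumn s.
  by rewrite leqNgt ltnS leq_pmulr.
elim: s {s_gt0} (_.+1) ks => //= x s IHs k; rewrite inE => /predU1P[->|/IHs].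
  exact: leq_addr.
by move=> /leq_trans; apply; apply: leq_addl.
Qed.

(* s lists the values found so far, the last one at the head. The default 0
   only serves to make the function total: the head is positive as soon as
   the initial value a below is. *)
Definition next (s : seq nat) : nat :=
  if @idP (0 < head 0 s) is ReflectT s_gt0 then ex_minn (ex_fresh s_gt0)
  else 0.

(* [:: f_a(n); ...; f_a(2); f_a(1)] *)
Fixpoint fseq (a n : nat) : seq nat :=
  match n with
  | 0 => [::]
  | 1 => [:: 1]
  | 2 => [:: a; 1]
  | n'.+1 => let s := fseq a n' in next s :: s
  end.

(* The value f a 0 = 0 is a dummy. *)
Definition f (a n : nat) : nat := head 0 (fseq a n).

Lemma f1 (a : nat) : f a 1 = 1. Proof. by []. Qed.

Lemma f2 (a : nat) : f a 2 = a. Proof. by []. Qed.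

Lemma nextP (s : seq nat) : 0 < head 0 s ->
  fresh s (next s) /\ (forall k, fresh s k -> next s <= k).
Proof.
by rewrite /next => s_gt0; case: {-}_ / idP => // h; case: ex_minnP.
Qed.

Lemma fseqE (a n : nat) : 2 < n -> fseq a n = next (fseq a n.-1) :: fseq a n.-1.
Proof. by case: n => [|[|[]]]. Qed.

Lemma f_gt0 (a n : nat) : 0 < a -> 0 < n -> 0 < f a n.
Proof.
move=> a_gt0; elim: n => [|[|[|n]] IHn] // _.
by rewrite /f fseqE //=; have [/and3P[]] := nextP (IHn isT).
Qed.

Lemma mem_fseq (a n : nat) : fseq a n =i [seq f a i | i <- iota 1 n].
Proof.
elim: n => [|n IHn] // k.
rewrite -addn1 iotaD map_cat mem_cat -IHn addn1 add1n orbC !inE /f.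
by case: n {IHn} => [|[|n]] //=; rewrite !inE ?in_nil ?orbF.
Qed.

Lemma f_rec (a n : nat) : 0 < a -> 2 < n ->
  let admissible k :=
    [&& 0 < k, k \notin [seq f a i | i <- iota 1 n.-1] & coprime k (f a n.-1)] in
  admissible (f a n) /\ (forall k, admissible k -> f a n <= k).
Proof.
move=> a_gt0 n_gt2 /=; have fn_gt0 : 0 < f a n.-1.
  by apply: f_gt0 => //; case: n n_gt2 => [|[]].
have -> : f a n = next (fseq a n.-1) by rewrite /f fseqE.
rewrite -mem_fseq; have [Hn min_n] := nextP fn_gt0.
by split=> // k; rewrite -mem_fseq; apply: min_n.
Qed.

Lemma ex_notin_1a (a : nat) : exists k, [&& 0 < k, k != 1 & k != a].
Proof.
by exists a.+2; rewrite gtn_eqF // gtn_eqF //.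
Qed.

Definition min_notin_1a (a : nat) : nat := ex_minn (ex_notin_1a a).

(* Truncated subtraction is harmless in [1 < x - y]. *)
Definition turning_point (a t : nat) : Prop :=
  (3 < t /\ 1 < f a t - f a (t - 1)) \/ (t = 3 /\ f a 3 <> min_notin_1a a).

Definition ETP (a t : nat) : Prop :=
  [/\ turning_point a t,
      a < t /\ f a t <> t,
      f a (t - 1) = t - 2
    & iota 1 (t - 1) =i [seq f a i | i <- iota 1 (t - 1)]].

Definition C3 (g : nat -> nat) : Prop :=
  exists b : nat,
    [/\ 0 < b, g = f b & exists m : nat, forall n : nat, m < n -> g n = f 3 n].

(* Main.v *)
Require Import Defs.
From mathcomp Require Import all_boot zify.

Set Implicit Arguments.
Unset Strict Implicit.
Unset Printing Implicit Defensive.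

(** Write [f] for [f_a]. Suppose that at some time the values used so far are
    exactly [1 .. m+1] and that the last one is [m], with [m] even; call such an
    [m] a milestone. Let [p] be the least integer greater than 1 coprime to [m];
    it is odd. The next value is [m + p], because a number [m + d] is coprime
    to [m] exactly when [d] is. Then comes [m + 2]: a common prime factor of
    [m + 2] and [m + p] is smaller than [p], so it divides [m], so it divides 2,
    while [m + p] is odd. From there on the sequence runs through consecutive
    integers until it meets [m + p], and at that time [m + p - 1] is the next
    milestone ([milestone_step]).

    For odd [a >= 3] the sequence starts [1, a, 2, 3, ..., a - 1], so [a - 1] is
    a milestone of [f_a], and 2 is one of [f_3]. The point is that a jump of one
    orbit of [m |-> m + p - 1] cannot be straddled by another orbit: if [m'] is
    even and lies strictly between [m] and [m + p - 1], a prime factor of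
    [m + p - m'] does not divide [m'] ([least_coprime_nested]), so the jump from
    [m'] does not go beyond [m + p - 1]. Hence the two orbits have a
    common milestone, and from a common milestone on the two functions agree,
    since they have used the same values and have the same last value.

    An essential turning point [t] is even for a more elementary reason: if [t]
    were odd, it would be coprime to [t - 2 = f (t - 1)]; as the values before it
    are [1 .. t - 1], it is also the least unused number, so [f t] would be [t]. *)

Definition values (a n : nat) : seq nat := [seq f a i | i <- iota 1 n].

Lemma mem_valuesS (a n k : nat) :
  (k \in values a n.+1) = (k \in values a n) || (k == f a n.+1).
Proof. by rewrite /values -[n.+1]addn1 iotaD map_cat mem_cat mem_seq1 add1n addn1. Qed.

Lemma f_eq (a n k : nat) : 0 < a -> 1 < n ->
    0 < k -> k \notin values a n -> coprime k (f a n) ->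
    (forall d, 0 < d -> d \notin values a n -> coprime d (f a n) -> k <= d) ->
  f a n.+1 = k.
Proof.
move=> a_gt0 n_gt1 k_gt0 k_new k_cop k_min.
have [/and3P[f_pos f_new f_cop] f_min] := @f_rec a n.+1 a_gt0 n_gt1.
apply/eqP; rewrite eqn_leq k_min // andbT; apply: f_min.
by rewrite k_gt0 k_cop andbT.
Qed.

Lemma ETP_even (a t : nat) : 3 <= a -> ETP a t -> ~~ odd t.
Proof.
move=> a_ge3 [_ [lt_at ft_neq] ft1 vals]; apply/negP => t_odd; apply: ft_neq.
have mem_vals d : (d \in values a t.-1) = (0 < d < t).
  by rewrite /values -subn1 -vals mem_iota; lia.
case: t => [|t] // in lt_at t_odd ft1 vals mem_vals *.
rewrite subSS subn0 in ft1.
apply: f_eq; rewrite ?mem_vals ?ft1; try lia.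
- have -> : t.+1 = (t.+1 - 2) + 2 by lia.
  rewrite addnK /coprime gcdnC gcdnDl -/(coprime _ _) coprimen2; lia.
- by move=> d; rewrite mem_vals; lia.
Qed.

Definition least_coprime (m p : nat) : Prop :=
  [/\ 1 < p, coprime p m & forall d, 1 < d -> coprime d m -> p <= d].

Lemma ex_least_coprime (m : nat) : 0 < m -> exists p, least_coprime m p.
Proof.
move=> m_gt0; have ex : exists d, (1 < d) && coprime d m.
  by exists m.+1; rewrite coprimeSn andbT.
case: (ex_minnP ex) => p /andP[p_gt1 p_cop] p_min; exists p; split=> // d d1 dm.
by apply: p_min; rewrite d1.
Qed.

Lemma least_coprime_odd (m p : nat) : ~~ odd m -> least_coprime m p -> odd p.
Proof.
move=> m_even [_ p_cop _]; rewrite -coprimen2.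
by apply: coprime_dvdr p_cop; rewrite dvdn2.
Qed.

Lemma prime_dvd_lt_least_coprime (m p s : nat) :
  least_coprime m p -> prime s -> s < p -> s %| m.
Proof.
move=> [_ _ p_min] s_pr lt_sp; apply: contraLR lt_sp; rewrite -prime_coprime //.
by rewrite -leqNgt; apply/p_min/prime_gt1.
Qed.

Definition milestone (a m : nat) : Prop :=
  [/\ 1 < m, ~~ odd m, f a m.+1 = m
    & forall k, (k \in values a m.+1) = (0 < k <= m.+1)].

(** Consecutive integers being coprime, the sequence fills the gap below a
    value [q] reached in advance. *)
Lemma run_to_milestone (a m q : nat) : 0 < a -> 1 < m < q -> odd q ->
    f a m.+1 = m ->
    (forall k, (k \in values a m.+1) = (0 < k <= m) || (k == q)) ->
  milestone a q.-1.
Proof.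
move=> a_gt0 /andP[m_gt1 lt_mq] q_odd.
have [j def_q] : exists j, q = (m + j).+1 by exists (q - m.+1); lia.
elim: j => [|j IHj] in m m_gt1 lt_mq def_q * => fm vals.
  split; rewrite def_q addn0 /= ?vals //; first by lia.
  by move=> k; rewrite vals; lia.
have fm1 : f a m.+2 = m.+1.
  apply: f_eq; rewrite ?vals ?fm ?coprimeSn //; try lia.
  by move=> d; rewrite vals; lia.
apply: (IHj m.+1) => //; try lia.
by move=> k; rewrite mem_valuesS vals fm1; lia.
Qed.

Lemma milestone_init (a : nat) : 3 <= a -> odd a -> milestone a a.-1.
Proof.
move=> a_ge3 a_odd; have a_gt0 : 0 < a by lia.
have vals2 k : (k \in values a 2) = (k == 1) || (k == a).
  by rewrite !inE.
have fa3 : f a 3 = 2.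
  apply: f_eq; rewrite ?vals2 ?coprime2n //; try lia.
  by move=> d; rewrite vals2; lia.
apply: (@run_to_milestone a 2) => //.
by move=> k; rewrite mem_valuesS vals2 fa3; lia.
Qed.

Lemma milestone_step (a m p : nat) :
  0 < a -> milestone a m -> least_coprime m p -> milestone a (m + p - 1).
Proof.
move=> a_gt0 [m_gt1 m_even fm vals] lcp.
have p_odd := least_coprime_odd m_even lcp.
have [p_gt1 p_cop p_min] := lcp.
have f_jump : f a m.+2 = m + p.
  apply: f_eq => //; rewrite ?vals ?fm /coprime ?gcdnDl; try lia.
    by rewrite gcdnC gcdnDl gcdnC.
  move=> d d_gt0; rewrite vals d_gt0 /= -ltnNge => lt_md.
  (* Above [m], the candidates are the [m + e] with [e > 1] coprime to [m]. *)
  have -> : d = m + (d - m) by lia.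
  rewrite gcdnC gcdnDl gcdnC leq_add2l => d_cop.
  by apply: p_min => //; lia.
have vals' k : (k \in values a m.+2) = (0 < k <= m.+1) || (k == m + p).
  by rewrite mem_valuesS vals f_jump.
have m2_cop : coprime m.+2 (m + p).
  rewrite coprime_has_primes //; last by lia.
  apply/hasPn => s; rewrite !mem_primes => /and3P[s_pr _ s_dvd_mp].
  apply/negP => /and3P[_ _ s_dvd_m2].
  have le_sp : s <= p - 2.
    apply: dvdn_leq; first by lia.
    have -> : p - 2 = m + p - m.+2 by lia.
    exact: dvdn_sub.
  have s_dvd_m := prime_dvd_lt_least_coprime lcp s_pr (_ : s < p).
  have s_eq2 : s = 2.
    apply/eqP; rewrite -dvdn_prime2 // -(@dvdn_addr m) ?addn2 //.
    by apply: s_dvd_m; lia.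
  by move: s_dvd_mp; rewrite s_eq2 dvdn2; lia.
have fm3 : f a m.+3 = m.+2.
  apply: f_eq => //; rewrite ?vals' ?f_jump //; try lia.
  by move=> d; rewrite vals'; lia.
rewrite subn1; apply: (@run_to_milestone a m.+2) => //; try lia.
by move=> k; rewrite mem_valuesS vals' fm3; lia.
Qed.

(** The witness is any prime factor [s] of [m + p - m']: it is smaller than
    [p], hence divides [m]; if it divided [m'] too, it would divide [p], which is
    coprime to [m]. *)
Lemma least_coprime_nested (m p m' r : nat) :
    least_coprime m p -> least_coprime m' r -> m < m' -> m' + 1 < m + p ->
  m' + r <= m + p.
Proof.
move=> lcp [_ _ r_min] lt_mm' lt_m'p.
have [_ p_cop _] := lcp.
set s := pdiv (m + p - m').
have s_pr : prime s by apply: pdiv_prime; lia.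
have s_dvd : s %| m + p - m' := pdiv_dvd _.
have le_s : s <= m + p - m' by apply: dvdn_leq => //; lia.
have s_dvd_m : s %| m by apply: (prime_dvd_lt_least_coprime lcp) => //; lia.
suff le_rs : r <= s by lia.
apply: r_min; first exact: prime_gt1.
rewrite prime_coprime //; apply/negP => s_dvd_m'.
have s_dvd_p : s %| p.
  rewrite -(dvdn_addr _ s_dvd_m).
  have -> : m + p = m + p - m' + m' by lia.
  exact: dvdn_add.
have : s %| gcdn p m by rewrite dvdn_gcd s_dvd_p.
by rewrite (eqP p_cop) dvdn1 gtn_eqF ?prime_gt1.
Qed.

(** Started inside a jump of another orbit, an orbit stays inside that jump by
    [least_coprime_nested] and strictly increases, so it reaches the end. *)
Lemma milestone_catch_up (b m p m' : nat) : 0 < b -> ~~ odd m ->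
    least_coprime m p -> milestone b m' -> m < m' <= m + p - 1 ->
  milestone b (m + p - 1).
Proof.
move=> b_gt0 m_even lcp; have p_odd := least_coprime_odd m_even lcp.
have [k] := ubnP (m + p - m'); elim: k m' => // k IHk m' le_k mil_m'.
move=> /andP[lt_mm' le_m'].
have [m'_gt1 m'_even _ _] := mil_m'.
have [<-|neq_m'] := eqVneq m' (m + p - 1) => //.
have [r lcr] : exists r, least_coprime m' r by apply: ex_least_coprime; lia.
have le_r : m' + r <= m + p by apply: least_coprime_nested lcp lcr _ _; lia.
have [r_gt1 _ _] := lcr.
by apply: IHk (milestone_step b_gt0 mil_m' lcr) _; lia.
Qed.

(** The orbit that is behind jumps until it hits [m'] or jumps over it; in the
    second case the other orbit catches up at the end of that jump. *)
Lemma common_milestone (a b m m' : nat) : 0 < a -> 0 < b ->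
    milestone a m -> milestone b m' -> m <= m' ->
  exists M, milestone a M /\ milestone b M.
Proof.
move=> a_gt0 b_gt0; have [k] := ubnP (m' - m).
elim: k m => // k IHk m le_k mil_m mil_m' le_mm'.
have [m_gt1 m_even _ _] := mil_m.
have [eq_mm'|neq_mm'] := eqVneq m m'; first by exists m'; rewrite -{1}eq_mm'.
have [p lcp] : exists p, least_coprime m p by apply: ex_least_coprime; lia.
have [p_gt1 _ _] := lcp.
have mil_next := milestone_step a_gt0 mil_m lcp.
have [le_next|lt_next] := leqP (m + p - 1) m'.
  by apply: IHk mil_next mil_m' le_next; lia.
exists (m + p - 1); split=> //.
by apply: milestone_catch_up mil_m' _ => //; lia.
Qed.

Lemma eq_after_common_milestone (a b M : nat) : 0 < a -> 0 < b ->
  milestone a M -> milestone b M -> forall n, M < n -> f a n = f b n.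
Proof.
move=> a_gt0 b_gt0 [M_gt1 _ faM va] [_ _ fbM vb] n lt_Mn.
suff [] : f a n = f b n /\ values a n =i values b n by [].
rewrite -(subnKC lt_Mn); elim: (n - M.+1) => [|j [eq_f eq_v]].
  by rewrite addn0 faM fbM; split=> // k; rewrite va vb.
have n_gt1 : 1 < M.+1 + j by lia.
rewrite addnS; have eq_fS : f a (M.+1 + j).+1 = f b (M.+1 + j).+1.
  have [/and3P[pos new cop] f_min] := @f_rec b (M.+1 + j).+1 b_gt0 n_gt1.
  apply: f_eq => //; rewrite ?eq_v ?eq_f // => d d_gt0 d_new d_cop.
  by apply: f_min; rewrite d_gt0 d_cop andbT -[map _ _]/(values b _) -eq_v.
by split=> // k; rewrite mem_valuesS [RHS]mem_valuesS eq_v eq_fS.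
Qed.

Theorem theorem2p4 (a : nat) (a_ge3 : 3 <= a) (a_odd : odd a) :
  (forall t : nat, ETP a t -> ~~ odd t) /\ C3 (f a).
Proof.
split=> [t|]; first exact: ETP_even.
have a_gt0 : 0 < a by lia.
have [|||M [mil3 mila]] := @common_milestone 3 a 2 a.-1 isT a_gt0.
- exact: milestone_init.
- exact: milestone_init.
- by lia.
exists a; split=> //; exists M; exact: eq_after_common_milestone.
Qed.
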